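(* Let $\{G_n(x)\}_{n\ge0}$ be a generalized Fibonacci polynomial sequence (GFP), and let $m,r$ be non-negative integers. (1) (Catalan identity) If $m\ge r$, then $$\begin{vmatrix} G_m(x) & G_{m+r}(x)\\ G_{m-r}(x) & G_m(x)\end{vmatrix}=(-1)^{m-r}g^{m-r}(x)\begin{vmatrix} G_r(x) & G_{2r}(x)\\ G_0(x) & G_r(x)\end{vmatrix}.$$ (2) (Cassini identity) If $m\ge 1$, then $$\begin{vmatrix} G_m(x) & G_{m+1}(x)\\ G_{m-1}(x) & G_m(x)\end{vmatrix}=(-1)^{m-1}g(x)^{m-1}\begin{vmatrix} G_1(x) & G_2(x)\\ G_0(x) & G_1(x)\end{vmatrix}.$$
   Context: A generalized Fibonacci polynomial sequence (GFP) is a sequence in $\mathbb{Z}[x]$ given by $G_0(x)=p_0(x)$, $G_1(x)=p_1(x)$, $G_n(x)=d(x)G_{n-1}(x)+g(x)G_{n-2}(x)$ for $n\ge 2$, where $p_0(x)$ is a constant and $p_1(x),d(x),g(x)$ are non-zero polynomials in $\mathbb{Z}[x]$ with $\gcd(d(x),g(x))=1$. Standing assumption when $p_0\ne 0$: $\gcd(p_0(x),p_1(x))=\gcd(p_0(x),d(x))=\gcd(p_0(x),g(x))=1$. Vertical bars denote the determinant. *)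

(* Defs.v *)
From HB Require Import structures.
From mathcomp Require Import all_boot all_order all_algebra.

Set Implicit Arguments.
Unset Strict Implicit.
Unset Printing Implicit Defensive.

Import GRing.Theory.
Local Open Scope ring_scope.

(* Divisibility in the ring Z[x] itself.  polydiv's [p %| q], [gcdp] and
   [coprimep] are pseudo-division notions, i.e. they compute in Q[x] and treat
   every non-zero integer as a unit, so that they would make a coprimality
   condition involving a non-zero constant p0 vacuous. *)
Definition zdvdp (a b : {poly int}) : Prop := exists c : {poly int}, b = c * a.

(* [c] is a greatest common divisor of [a] and [b] in Z[x]; gcds are defined up
   to units, so gcd(a, b) = 1 reads [zgcdp_is a b 1]. *)
Definition zgcdp_is (a b c : {poly int}) : Prop :=
  [/\ zdvdp c a, zdvdp c b
    & forall e : {poly int}, zdvdp e a -> zdvdp e b -> zdvdp e c].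

Record is_GFP (p0 p1 d g : {poly int}) (G : nat -> {poly int}) : Prop := IsGFP {
  GFP_p0_const : (size p0 <= 1)%N;
  GFP_p1_neq0 : p1 != 0;
  GFP_d_neq0 : d != 0;
  GFP_g_neq0 : g != 0;
  GFP_gcd_dg : zgcdp_is d g 1;
  GFP_gcd_p0 :
    p0 != 0 -> [/\ zgcdp_is p0 p1 1, zgcdp_is p0 d 1 & zgcdp_is p0 g 1];
  GFP_0 : G 0%N = p0;
  GFP_1 : G 1%N = p1;
  GFP_rec : forall n : nat, (2 <= n)%N -> G n = d * G (n - 1)%N + g * G (n - 2)%N
}.

Definition mx22 (R : Type) (a b c e : R) : 'M[R]_2 :=
  \matrix_(i < 2, j < 2)
    if i == 0 then (if j == 0 then a else b) else (if j == 0 then c else e).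

(* Main.v *)
Require Import Defs.
From HB Require Import structures.
From mathcomp Require Import all_boot all_order all_algebra.
From mathcomp Require Import ring.

Import GRing.Theory.
Local Open Scope ring_scope.

(** Both identities are about one Wronskian-like quantity.  For two solutions
    [u] and [v] of the recurrence [w_(n+2) = d w_(n+1) + g w_n], consider the
    spread Casoratian [u_n v_(n+s) - u_(n+s) v_n].  For [s = 1] it is the
    determinant of the state matrix of the pair [(u, v)], and one step of the
    recurrence multiplies that matrix by a companion matrix of determinant
    [- g].  For fixed [n] it is a linear combination of shifts of [u] and [v],
    hence itself a solution of the recurrence in [s], vanishing at [s = 0]; so
    the factor [- g] per step in [n] propagates from [s = 1] to every [s]
    ([casoratianS]), and iterating gives the factor [(- g) ^+ n]
    ([casoratianE]).  Catalan's determinant is the spread Casoratian of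
    [u_n = G_(n+r)] and [v_n = G_n] at [s = r] and [n = m - r]
    ([catalan_identity]); Cassini's identity is the case [r = 1]. *)

Section SecondOrderRecurrence.

Variables (R : comPzRingType) (d g : R).

Definition second_order (u : nat -> R) : Prop :=
  forall n, u n.+2 = d * u n.+1 + g * u n.

Definition casoratian (u v : nat -> R) (s n : nat) : R :=
  u n * v (n + s)%N - u (n + s)%N * v n.

Lemma second_order_shift (u : nat -> R) (r : nat) :
  second_order u -> second_order (fun n => u (n + r)%N).
Proof. by move=> uP n /=; rewrite !addSn uP. Qed.

(** The Casoratian solves the recurrence in the spread because [u_n] and [v_n]
    act as constants once [n] is fixed. *)
Lemma casoratian_spread (u v : nat -> R) (n : nat) :
  second_order u -> second_order v ->
  second_order (fun s => casoratian u v s n).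
Proof. by move=> uP vP s; rewrite /casoratian !addnS uP vP; ring. Qed.

(** In the spread [s], both sides solve the same recurrence, so that it is
    enough to compare them at [s = 0], where they vanish, and at [s = 1], where
    the equality is the multiplicativity of the determinant described above. *)
Lemma casoratianS (u v : nat -> R) (s n : nat) :
  second_order u -> second_order v ->
  casoratian u v s n.+1 = - g * casoratian u v s n.
Proof.
move=> uP vP.
suff [] : casoratian u v s n.+1 = - g * casoratian u v s n
  /\ casoratian u v s.+1 n.+1 = - g * casoratian u v s.+1 n by [].
elim: s => [|s [IHs IHs1]]; split=> //.
- by rewrite /casoratian !addn0; ring.
- by rewrite /casoratian !addn1 uP vP; ring.
- by rewrite !(casoratian_spread _ _ _ uP vP) IHs IHs1; ring.
Qed.

Lemma casoratianE (u v : nat -> R) (s n : nat) :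
  second_order u -> second_order v ->
  casoratian u v s n = (- g) ^+ n * casoratian u v s 0.
Proof.
move=> uP vP; elim: n => [|n IHn]; first by rewrite expr0 mul1r.
by rewrite casoratianS // IHn exprS mulrA.
Qed.

Lemma catalan_identity (u : nat -> R) (m r : nat) :
  second_order u -> (r <= m)%N ->
  u m * u m - u (m + r)%N * u (m - r)%N
  = (- g) ^+ (m - r) * (u r * u r - u (2 * r)%N * u 0%N).
Proof.
move=> uP le_rm.
have := casoratianE _ _ r (m - r) (second_order_shift _ r uP) uP.
by rewrite /casoratian subnK // !add0n addnn -mul2n.
Qed.

End SecondOrderRecurrence.

Lemma det_mx22 (R : comPzRingType) (a b c e : R) :
  \det (mx22 a b c e) = a * e - b * c.
Proof.
rewrite (expand_det_row _ ord0) !big_ord_recl big_ord0 /cofactor !det_mx11 !mxE /=.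
by ring.
Qed.

Lemma GFP_second_order (p0 p1 d g : {poly int}) (G : nat -> {poly int}) :
  is_GFP p0 p1 d g G -> second_order _ d g G.
Proof. by move=> hG n; rewrite (GFP_rec hG) // subn1 subn2. Qed.

Theorem corollary13 (p0 p1 d g : {poly int}) (G : nat -> {poly int})
    (hG : is_GFP p0 p1 d g G) (m r : nat) :
  ((r <= m)%N ->
     \det (mx22 (G m) (G (m + r)%N) (G (m - r)%N) (G m))
     = (-1) ^+ (m - r)%N * g ^+ (m - r)%N
       * \det (mx22 (G r) (G (2 * r)%N) (G 0%N) (G r)))
  /\
  ((1 <= m)%N ->
     \det (mx22 (G m) (G (m + 1)%N) (G (m - 1)%N) (G m))
     = (-1) ^+ (m - 1)%N * g ^+ (m - 1)%N
       * \det (mx22 (G 1%N) (G 2%N) (G 0%N) (G 1%N))).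
Proof.
have catalan k : (k <= m)%N ->
    \det (mx22 (G m) (G (m + k)%N) (G (m - k)%N) (G m))
    = (-1) ^+ (m - k)%N * g ^+ (m - k)%N
      * \det (mx22 (G k) (G (2 * k)%N) (G 0%N) (G k)).
  move=> le_km; rewrite !det_mx22 -exprNn.
  exact: catalan_identity (GFP_second_order _ _ _ _ _ hG) le_km.
by split; [exact: catalan | exact: (catalan 1%N)].
Qed.
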